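(* Let $G$ be a finite group. If $G$ is lossless, then the function $\mathcal{R} \mapsto \pi^*(\mathcal{R})$ from the set of liftable categorical transfer systems on the poset $\mathrm{Sub}(G)/G$ to the set of $G$-transfer systems (equivalently, homotopy classes of $G$-$N_\infty$ operads) is a bijection. Furthermore, for a general finite group $G$, if $\pi^*$, restricted to liftable categorical transfer systems on $\mathrm{Sub}(G)/G$, is a bijection onto the set of $G$-transfer systems, then $G$ is lossless.
   Context: Notation: for a finite group $G$, $\mathrm{Sub}(G)$ is the poset of subgroups of $G$ under inclusion, ${}^gH := gHg^{-1}$, $[H]$ is the conjugacy class of $H \leqslant G$, and $\mathrm{Sub}(G)/G$ is the poset of conjugacy classes of subgroups, with $[K] \leqslant [H]$ iff some conjugate of $K$ is contained in $H$. $\pi\colon \mathrm{Sub}(G) \to \mathrm{Sub}(G)/G$, $H \mapsto [H]$, is the quotient map. A $G$-transfer system is a relation $\mathcal{R}$ on $\mathrm{Sub}(G)$ refining inclusion ($K\,\mathcal{R}\,H$ implies $K \leqslant H$) which is reflexive, transitive, closed under conjugation ($K\,\mathcal{R}\,H$ implies ${}^gK\,\mathcal{R}\,{}^gH$ for all $g\in G$) and closed under restriction ($K\,\mathcal{R}\,H$ and $L \leqslant H$ imply $(K\cap L)\,\mathcal{R}\,L$). By a known theorem, $G$-transfer systems are in bijection with homotopy classes of $G$-$N_\infty$ operads. A categorical transfer system on a poset $(\mathcal{P},\leqslant)$ is a partial order $\mathcal{R}$ on $\mathcal{P}$ refining $\leqslant$ such that whenever $x\,\mathcal{R}\,y$ and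 $z \leqslant y$, then for every maximal element $w$ of $x^{\downarrow}\cap z^{\downarrow}$ we have $w\,\mathcal{R}\,z$, where $x^{\downarrow}=\{y : y \leqslant x\}$. $G$ is lossless if for all subgroups $K\leqslant H \leqslant G$ and all $g \in G$ with ${}^gK\leqslant H$, there exists $h\in N_G(H)$ with ${}^hK={}^gK$. For a relation $\mathcal{R}$ on $\mathrm{Sub}(G)/G$, $\pi^{-1}(\mathcal{R})$ is the relation on $\mathrm{Sub}(G)$ consisting of the pairs $(K,H)$ with $K \leqslant H$ and $[K]\,\mathcal{R}\,[H]$, and $\pi^*(\mathcal{R})$ is the $G$-transfer system generated by $\pi^{-1}(\mathcal{R})$ (the smallest $G$-transfer system containing it). For a $G$-transfer system $\mathcal{R}$, $\pi_*(\mathcal{R})$ is the relation on $\mathrm{Sub}(G)/G$ in which $[K]$ is related to $[H]$ iff there exist $K'\leqslant H'$ with $[K']=[K]$, $[H']=[H]$ and $K'\,\mathcal{R}\,H'$. A categorical transfer system $\mathcal{R}$ on $\mathrm{Sub}(G)/G$ is liftable if $\mathcal{R}=\pi_*(\pi^*(\mathcal{R}))$. *)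

(* Defs.v *)
From HB Require Import structures.
From mathcomp Require Import all_boot all_order all_fingroup.

Set Implicit Arguments.
Unset Strict Implicit.
Unset Printing Implicit Defensive.

Local Open Scope group_scope.

(* The finite group is a whole [gT : finGroupType], so Sub(G) is the type
   [{group gT}].  Relations on a finite type are sets of pairs.
   MathComp conjugates on the right, H :^ x = x^-1 H x, so the conjugate
   gHg^-1 is written H :^ g^-1. *)

Definition lossless (gT : finGroupType) : Prop :=
  forall (K H : {group gT}) (g : gT),
    K \subset H -> K :^ g^-1 \subset H ->
    exists2 h : gT, h \in 'N(H) & K :^ h^-1 = K :^ g^-1.

Definition is_transfer_system (gT : finGroupType)
    (R : {set {group gT} * {group gT}}) : bool :=
  [&& [forall K, forall H, ((K, H) \in R) ==> (K \subset H)],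
      [forall H, (H, H) \in R],
      [forall L, forall K, forall H,
         ((L, K) \in R) && ((K, H) \in R) ==> ((L, H) \in R)],
      [forall g : gT, forall K, forall H,
         ((K, H) \in R) ==> (((K :^ g^-1)%G, (H :^ g^-1)%G) \in R)]
    & [forall K, forall H, forall L : {group gT},
         ((K, H) \in R) && (L \subset H) ==> (((K :&: L)%G, L) \in R)]].

Definition transfer_system (gT : finGroupType) :=
  {R : {set {group gT} * {group gT}} | is_transfer_system R}.

Section CategoricalTransfer.
Local Open Scope order_scope.

Definition maximal_lower_bound d (T : finPOrderType d) (x z w : T) : bool :=
  [&& w <= x, w <= z
    & [forall v, (v <= x) && (v <= z) && (w <= v) ==> (v == w)]].

Definition is_cat_transfer_system d (T : finPOrderType d) (R : {set T * T})
    : bool :=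
  [&& [forall x, (x, x) \in R],
      [forall x, forall y, ((x, y) \in R) && ((y, x) \in R) ==> (x == y)],
      [forall x, forall y, forall z,
         ((x, y) \in R) && ((y, z) \in R) ==> ((x, z) \in R)],
      [forall x, forall y, ((x, y) \in R) ==> (x <= y)]
    & [forall x, forall y, forall z, forall w,
         [&& (x, y) \in R, z <= y & maximal_lower_bound x z w]
           ==> ((w, z) \in R)]].

End CategoricalTransfer.

(* Sub(G)/G; a class [H] is the orbit of H under the conjugation action 'JG
   of G on {group gT}. *)
Definition is_sub_class (gT : finGroupType) (C : {set {group gT}}) : bool :=
  [exists H : {group gT}, C == orbit 'JG [set: gT] H].

Record sub_class (gT : finGroupType) := SubClass {
  class_set :> {set {group gT}};
  _ : is_sub_class class_set
}.

HB.instance Definition _ (gT : finGroupType) :=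
  [isSub for @class_set gT].
HB.instance Definition _ (gT : finGroupType) :=
  [Countable of sub_class gT by <:].
HB.instance Definition _ (gT : finGroupType) :=
  [Finite of sub_class gT by <:].

Lemma orbit_is_sub_class (gT : finGroupType) (H : {group gT}) :
  is_sub_class (orbit 'JG [set: gT] H).
Proof. by apply/existsP; exists H. Qed.

Definition class_of (gT : finGroupType) (H : {group gT}) : sub_class gT :=
  SubClass (orbit_is_sub_class H).

(* [C] <= [D] iff some member of C is contained in some member of D;
   [class_leE] recovers "some conjugate of K is contained in H". *)
Definition class_le (gT : finGroupType) (C D : sub_class gT) : bool :=
  [exists K : {group gT}, exists H : {group gT},
     [&& class_of K == C, class_of H == D & K \subset H]].

Lemma class_ofP (gT : finGroupType) (C : sub_class gT) :
  exists H, C = class_of H.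
Proof.
by case: C => C CP; have /existsP[H /eqP dC] := CP; exists H; apply: val_inj.
Qed.

Lemma class_of_eqP (gT : finGroupType) (K H : {group gT}) :
  reflect (exists g : gT, K = (H :^ g^-1)%G) (class_of K == class_of H).
Proof.
rewrite -val_eqE /=; apply: (iffP idP) => [/eqP eKH | [g ->]].
  have: K \in orbit 'JG [set: gT] H by rewrite -eKH orbit_refl.
  by case/orbitP=> g _ <-; exists g^-1; rewrite invgK.
by apply/eqP/orbit_eqP/orbitP; exists g^-1; rewrite ?inE.
Qed.

Lemma class_leE (gT : finGroupType) (K H : {group gT}) :
  class_le (class_of K) (class_of H) = [exists g : gT, K :^ g^-1 \subset H].
Proof.
apply/existsP/existsP => [[K1 /existsP[H1]] | [g sKH]].
  case/and3P=> /class_of_eqP[x ->] /class_of_eqP[y ->] /= sKH.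
  by exists (y^-1 * x); rewrite invMg invgK conjsgM sub_conjg.
exists (K :^ g^-1)%G; apply/existsP; exists H; apply/and3P; split=> //.
by apply/class_of_eqP; exists g.
Qed.

Lemma class_le_refl (gT : finGroupType) : reflexive (@class_le gT).
Proof.
move=> C; have [H ->] := class_ofP C; rewrite class_leE.
by apply/existsP; exists 1; rewrite invg1 conjsg1.
Qed.

Lemma class_le_anti (gT : finGroupType) : antisymmetric (@class_le gT).
Proof.
move=> C D; have [H ->] := class_ofP C; have [K ->] := class_ofP D.
rewrite !class_leE => /andP[/existsP[g sHK] /existsP[h sKH]].
apply/esym/eqP/class_of_eqP; exists g; apply/val_inj/eqP => /=.
rewrite eq_sym eqEcard sHK cardJg.
by rewrite -(cardJg K h^-1) subset_leq_card.
Qed.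

Lemma class_le_trans (gT : finGroupType) : transitive (@class_le gT).
Proof.
move=> D C E; have [H ->] := class_ofP C; have [K ->] := class_ofP D.
have [L ->] := class_ofP E.
rewrite !class_leE => /existsP[g sHK] /existsP[h sKL].
apply/existsP; exists (h * g); rewrite invMg conjsgM.
by apply: subset_trans sKL; rewrite conjSg.
Qed.

Fact sub_class_display : Order.disp_t.
Proof. exact: Order.Disp tt tt. Qed.

HB.instance Definition _ (gT : finGroupType) :=
  Order.Le_isPOrder.Build sub_class_display (sub_class gT)
    (@class_le_refl gT) (@class_le_anti gT) (@class_le_trans gT).

Definition pi_preim (gT : finGroupType) (R : {set sub_class gT * sub_class gT})
    : {set {group gT} * {group gT}} :=
  [set KH : {group gT} * {group gT} |
     (KH.1 \subset KH.2) && ((class_of KH.1, class_of KH.2) \in R)].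

Definition gen_transfer_system (gT : finGroupType)
    (R : {set {group gT} * {group gT}}) : {set {group gT} * {group gT}} :=
  \bigcap_(S : {set {group gT} * {group gT}} |
             is_transfer_system S && (R \subset S)) S.

Lemma sub_gen_transfer_system (gT : finGroupType)
    (R : {set {group gT} * {group gT}}) : R \subset gen_transfer_system R.
Proof. by apply/bigcapsP => S /andP[]. Qed.

Lemma gen_transfer_system_min (gT : finGroupType)
    (R S : {set {group gT} * {group gT}}) :
  is_transfer_system S -> R \subset S -> gen_transfer_system R \subset S.
Proof. by move=> tS sRS; apply: bigcap_inf; rewrite tS. Qed.

Lemma inclusion_is_transfer_system (gT : finGroupType) :
  is_transfer_system [set KH : {group gT} * {group gT} | KH.1 \subset KH.2].
Proof.
apply/and5P; split.
- by apply/forallP=> K; apply/forallP=> H; rewrite inE; apply/implyP.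
- by apply/forallP=> H; rewrite inE /=.
- apply/forallP=> L; apply/forallP=> K; apply/forallP=> H; rewrite !inE /=.
  by apply/implyP=> /andP[]; apply: subset_trans.
- apply/forallP=> g; apply/forallP=> K; apply/forallP=> H; rewrite !inE /=.
  by apply/implyP; rewrite conjSg.
- apply/forallP=> K; apply/forallP=> H; apply/forallP=> L; rewrite !inE /=.
  by rewrite subsetIr implybT.
Qed.

Lemma gen_is_transfer_system (gT : finGroupType)
    (R : {set {group gT} * {group gT}}) :
  (forall K H, (K, H) \in R -> K \subset H) ->
  is_transfer_system (gen_transfer_system R).
Proof.
move=> sR; apply/and5P; split.
- apply/forallP=> K; apply/forallP=> H; apply/implyP=> KH.
  suff /(_ _ KH): {subset gen_transfer_system R
      <= [set KH : {group gT} * {group gT} | KH.1 \subset KH.2]} by rewrite inE.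
  apply/subsetP/gen_transfer_system_min; first exact: inclusion_is_transfer_system.
  by apply/subsetP=> -[A B] /sR; rewrite inE.
- apply/forallP=> H; apply/bigcapP=> S /andP[/and5P[_ /forallP-> //]].
- apply/forallP=> L; apply/forallP=> K; apply/forallP=> H.
  apply/implyP=> /andP[/bigcapP LK /bigcapP KH].
  apply/bigcapP=> S SP; have /andP[/and5P[_ _ tr _ _] _] := SP.
  move/forallP/(_ L)/forallP/(_ K)/forallP/(_ H)/implyP: tr.
  by apply; rewrite LK ?KH.
- apply/forallP=> g; apply/forallP=> K; apply/forallP=> H.
  apply/implyP=> /bigcapP KH.
  apply/bigcapP=> S SP; have /andP[/and5P[_ _ _ cj _] _] := SP.
  move/forallP/(_ g)/forallP/(_ K)/forallP/(_ H)/implyP: cj.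
  by apply; rewrite KH.
- apply/forallP=> K; apply/forallP=> H; apply/forallP=> L.
  apply/implyP=> /andP[/bigcapP KH sLH].
  apply/bigcapP=> S SP; have /andP[/and5P[_ _ _ _ rs] _] := SP.
  move/forallP/(_ K)/forallP/(_ H)/forallP/(_ L)/implyP: rs.
  by apply; rewrite KH.
Qed.

Lemma pi_pull_proof (gT : finGroupType)
    (R : {set sub_class gT * sub_class gT}) :
  is_transfer_system (gen_transfer_system (pi_preim R)).
Proof. by apply: gen_is_transfer_system => K H; rewrite inE => /andP[]. Qed.

(* pi^* *)
Definition pi_pull (gT : finGroupType)
    (R : {set sub_class gT * sub_class gT}) : transfer_system gT :=
  exist _ (gen_transfer_system (pi_preim R)) (pi_pull_proof R).

(* pi_* *)
Definition pi_push (gT : finGroupType) (S : transfer_system gT)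
    : {set sub_class gT * sub_class gT} :=
  [set CD : sub_class gT * sub_class gT |
     [exists K : {group gT}, exists H : {group gT},
        [&& K \subset H, class_of K == CD.1, class_of H == CD.2
          & (K, H) \in val S]]].

Definition liftable (gT : finGroupType)
    (R : {set sub_class gT * sub_class gT}) : bool :=
  R == pi_push (pi_pull R).

Definition liftable_cat_transfer_system (gT : finGroupType) :=
  {R : {set sub_class gT * sub_class gT} |
     is_cat_transfer_system R && liftable R}.

Definition pi_pull_liftable (gT : finGroupType)
    (R : liftable_cat_transfer_system gT) : transfer_system gT :=
  pi_pull (val R).

(* Main.v *)
Require Import Defs.
From mathcomp Require Import all_boot all_order all_fingroup.

(** Both halves rest on comparing a transfer system [S] with the relation
[pi_preim (pi_push S)], which saturates [S] under moving the source and the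
target of a transfer by two unrelated conjugations (keeping the inclusion).

If [G] is lossless this saturation is [S] itself ([pi_preim_push]): after
conjugating so that the targets agree, the two sources are conjugate subgroups
of the same [H], hence conjugate by an element of the normaliser of [H], and
[S] is stable under that conjugation.  So [pi_push] is a right inverse of
[pi_pull], and it is a left inverse on liftable relations by definition.  What
is left is that [pi_push S] is a categorical transfer system
([pi_push_is_cat]).  The restriction axiom uses losslessness once more: a
common lower bound [M] of [K] and [L] in the quotient, where [K] and [L] lie in
[H], is realised inside an honest intersection of [L] with a conjugate of [K] by
an element normalising [H], and maximality forces [M] to be that intersection
up to conjugacy.

Conversely, surjectivity of [pi_pull] makes every transfer system saturated
([surj_pull_saturated]).  For [K] contained in [H] there is a transfer system
[barrier K H] containing [(K, H)] in which the only subgroups of the order of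
[K] that transfer to [H] are the conjugates of [K] under the normaliser of [H]
([barrierJ]).  Saturation puts [(K^g, H)] in it for every conjugate [K^g]
contained in [H], which is losslessness. *)

Set Implicit Arguments.
Unset Strict Implicit.
Unset Printing Implicit Defensive.

Local Open Scope group_scope.

(** * Transfer systems and conjugacy classes of subgroups *)

Section Corollary.

Variable gT : finGroupType.
Implicit Types (K H L M A B : {group gT}) (S : transfer_system gT).

Lemma transfer_systemP (R : {set {group gT} * {group gT}}) :
  reflect
    [/\ forall K H, (K, H) \in R -> K \subset H,
        forall H, (H, H) \in R,
        forall L K H, (L, K) \in R -> (K, H) \in R -> (L, H) \in R,
        forall g K H, (K, H) \in R -> ((K :^ g)%G, (H :^ g)%G) \in R
      & forall K H L, (K, H) \in R -> L \subset H -> ((K :&: L)%G, L) \in R]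
    (is_transfer_system R).
Proof.
apply: (iffP and5P) => -[sub refl tr cj rs]; split.
- by move=> K H KH; move/forallP/(_ K)/forallP/(_ H)/implyP: sub; apply.
- exact/forallP.
- move=> L K H LK KH.
  move/forallP/(_ L)/forallP/(_ K)/forallP/(_ H)/implyP: tr.
  by apply; rewrite LK.
- move=> g K H KH.
  move/forallP/(_ g^-1)/forallP/(_ K)/forallP/(_ H)/implyP: cj.
  by rewrite invgK; apply.
- move=> K H L KH sLH.
  move/forallP/(_ K)/forallP/(_ H)/forallP/(_ L)/implyP: rs.
  by apply; rewrite KH.
- by apply/forallP=> K; apply/forallP=> H; apply/implyP; apply: sub.
- exact/forallP.
- apply/forallP=> L; apply/forallP=> K; apply/forallP=> H.
  by apply/implyP=> /andP[]; apply: tr.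
- apply/forallP=> g; apply/forallP=> K; apply/forallP=> H.
  by apply/implyP; apply: cj.
- apply/forallP=> K; apply/forallP=> H; apply/forallP=> L.
  by apply/implyP=> /andP[]; apply: rs.
Qed.

Lemma conjG_norm H h : h \in 'N(H) -> (H :^ h)%G = H.
Proof. by move=> Nh; apply/val_inj/normP. Qed.

Lemma class_ofJ K g : class_of (K :^ g)%G = class_of K.
Proof. by apply/eqP/class_of_eqP; exists g^-1; rewrite invgK. Qed.

Lemma class_of_eqJ K H : class_of K = class_of H -> exists g, K = (H :^ g)%G.
Proof. by move/eqP/class_of_eqP=> [g ->]; exists g^-1. Qed.

Lemma class_leP K H :
  reflect (exists g, K :^ g \subset H) (class_of K <= class_of H)%O.
Proof.
rewrite [(_ <= _)%O]class_leE.
apply: (iffP existsP) => -[g sKH]; exists g^-1 => //.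
by rewrite invgK.
Qed.

Lemma sub_class_le K H : K \subset H -> (class_of K <= class_of H)%O.
Proof. by move=> sKH; apply/class_leP; exists 1; rewrite conjsg1. Qed.

Lemma class_le_rep (C : sub_class gT) H :
  (C <= class_of H)%O -> exists2 K, C = class_of K & K \subset H.
Proof.
have [K ->] := class_ofP C; case/class_leP=> g sKH.
by exists (K :^ g)%G; rewrite ?class_ofJ.
Qed.

Lemma mem_pi_push S K H :
  (K, H) \in val S -> (class_of K, class_of H) \in pi_push S.
Proof.
move=> KH; rewrite inE; apply/existsP; exists K; apply/existsP; exists H.
by rewrite !eqxx KH; case/transfer_systemP: (valP S) => ->.
Qed.

(** Since transfers can be conjugated, the representative of the target class
may be prescribed. *)
Lemma pi_pushP S (C : sub_class gT) H :
  (C, class_of H) \in pi_push S ->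
  exists2 K, C = class_of K & (K, H) \in val S.
Proof.
have [_ _ _ cj _] := transfer_systemP _ (valP S).
rewrite inE => /existsP[K /existsP[H1]] /and4P[_ /eqP/= <-].
move=> /eqP/esym/class_of_eqJ[g ->] KH1.
by exists (K :^ g)%G; [rewrite class_ofJ | apply: cj].
Qed.

Lemma sub_pi_preim_push S : val S \subset pi_preim (pi_push S).
Proof.
apply/subsetP=> -[K H] KH; rewrite inE (mem_pi_push KH) andbT.
by case/transfer_systemP: (valP S) => + *; apply.
Qed.

(** * Lossless groups *)

Section Lossless.

Hypothesis llG : lossless gT.

Lemma losslessJ K H g :
    K \subset H -> K :^ g \subset H ->
  exists2 h, h \in 'N(H) & K :^ h = K :^ g.
Proof.
move=> sKH; rewrite -{1}[g]invgK => /(llG sKH)[h Nh]; rewrite invgK => eKh.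
by exists h^-1; rewrite ?groupV.
Qed.

(** Losslessness corrects the conjugation between the two sources to one that
fixes the target. *)
Lemma pi_preim_push S : pi_preim (pi_push S) = val S.
Proof.
apply/eqP; rewrite eqEsubset sub_pi_preim_push andbT.
have [sub _ _ cj _] := transfer_systemP _ (valP S).
apply/subsetP=> -[K H]; rewrite inE /=.
case/andP=> sKH /pi_pushP[K1 /class_of_eqJ[g defK] K1H].
rewrite defK in sKH *.
have [h Nh /= eK] := losslessJ (sub _ _ K1H) sKH.
have -> : (K1 :^ g)%G = (K1 :^ h)%G by apply: val_inj.
by rewrite -(conjG_norm Nh); apply: cj.
Qed.

Lemma pi_push_pull S : pi_pull (pi_push S) = S.
Proof.
apply: val_inj; rewrite /= pi_preim_push; apply/eqP.
by rewrite eqEsubset gen_transfer_system_min ?(valP S) // sub_gen_transfer_system.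
Qed.

(** For the restriction axiom, the maximal lower bound and the class to restrict
to get representatives [M] and [L] with [M] in [L] in [H]; losslessness then
replaces the source [K] by a conjugate containing [M] without moving the target
[H]. *)
Lemma pi_push_is_cat S : is_cat_transfer_system (pi_push S).
Proof.
have [sub refl tr cj rs] := transfer_systemP _ (valP S).
have push_le (C D : sub_class gT) : (C, D) \in pi_push S -> (C <= D)%O.
  have [H ->] := class_ofP D; case/pi_pushP=> K -> /sub; exact: sub_class_le.
apply/and5P; split.
- by apply/forallP=> C; have [H ->] := class_ofP C; apply: mem_pi_push.
- apply/forallP=> C; apply/forallP=> D; apply/implyP=> /andP[CD DC].
  by rewrite Order.POrderTheory.eq_le !push_le.
- apply/forallP=> C; apply/forallP=> D; apply/forallP=> E.
  have [H ->] := class_ofP E.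
  apply/implyP=> /andP[CD /pi_pushP[K defD KH]].
  rewrite {}defD in CD; have [L -> LK] := pi_pushP CD.
  exact/mem_pi_push/(tr _ _ _ LK).
- by apply/forallP=> C; apply/forallP=> D; apply/implyP/push_le.
apply/forallP=> C; apply/forallP=> D; apply/forallP=> E; apply/forallP=> W.
have [H ->] := class_ofP D; apply/implyP.
case/and3P=> /pi_pushP[K -> KH] /class_le_rep[L -> sLH].
case/and3P=> + /class_le_rep[M defW sML]; rewrite {W}defW.
move=> /class_leP[g sMgK] /forallP maxM.
have sMH: M \subset H := subset_trans sML sLH.
have [h Nh eMg] := losslessJ sMH (subset_trans sMgK (sub _ _ KH)).
have sMK: M \subset K :^ h^-1 by rewrite -sub_conjg eMg.
(* The conjugate of [K] that contains [M] still transfers to [H], as [h]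
   normalises [H]. *)
have KhH: ((K :^ h^-1)%G, H) \in val S.
  by rewrite -(@conjG_norm H h^-1) ?groupV //; apply: cj.
have := maxM (class_of (K :^ h^-1 :&: L)%G).
rewrite -{1}(class_ofJ K h^-1) !sub_class_le ?subsetIl ?subsetIr //=; last first.
  by rewrite subsetI sMK.
by move/eqP=> <-; apply: mem_pi_push; apply: rs KhH sLH.
Qed.

Lemma lossless_bij : bijective (@pi_pull_liftable gT).
Proof.
have catS S : is_cat_transfer_system (pi_push S) && liftable (pi_push S).
  by rewrite pi_push_is_cat /liftable pi_push_pull eqxx.
exists (fun S => exist _ (pi_push S) (catS S)) => [R | S].
- by apply: val_inj => /=; case/andP: (valP R) => _ /eqP.
- exact: pi_push_pull.
Qed.

End Lossless.

(** * Surjectivity of pi^* forces losslessness *)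

(** A liftable preimage of [S] can only be [pi_push S], so [S] contains the
saturation [pi_preim (pi_push S)]. *)
Lemma surj_pull_saturated S (R : liftable_cat_transfer_system gT) :
  pi_pull_liftable R = S -> pi_preim (pi_push S) \subset val S.
Proof.
move=> <-; have /andP[_ /eqP defR] := valP R.
rewrite /pi_pull_liftable -defR; exact: sub_gen_transfer_system.
Qed.

(** The transfer system generated by [(K, H)] is awkward to describe; this
larger one is just as restrictive on sources of order [#|K|].  Into groups of
larger order than [H] there are only the identities, since restricting a proper
transfer to [H] could create an unwanted one; into groups of smaller order every
inclusion is a transfer, so that restricting to a proper subgroup of [H] is
free. *)
Definition barrier K H : {set {group gT} * {group gT}} :=
  [set AB : {group gT} * {group gT} | (AB.1 \subset AB.2) &&
     [|| AB.1 == AB.2, #|AB.2| < #|H|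
       | [exists y, (AB.2 == (H :^ y)%G) && (AB.1 \subset K :^ y)]]].

Lemma barrierP K H A B :
  reflect (A \subset B /\ [\/ A = B, #|B| < #|H|
             | exists2 y, B = (H :^ y)%G & A \subset K :^ y])
          ((A, B) \in barrier K H).
Proof.
rewrite inE /=; apply: (iffP andP) => -[sAB AB]; split=> //.
  case/or3P: AB => [/eqP-> | ltBH | /existsP[y /andP[/eqP-> sAK]]].
  - by constructor 1.
  - by constructor 2.
  - by constructor 3; exists y.
apply/or3P; case: AB => [-> | ltBH | [y -> sAK]].
- by constructor 1.
- by constructor 2.
- by constructor 3; apply/existsP; exists y; rewrite eqxx.
Qed.

Lemma barrier_is_transfer_system K H : is_transfer_system (barrier K H).
Proof.
apply/transfer_systemP; split.
- by move=> A B /barrierP[].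
- by move=> A; apply/barrierP; split; [| constructor 1].
- move=> A B C AB /barrierP[sBC BC]; have /barrierP[sAB _] := AB.
  case: BC => [<- // | ltCH | [y defC sBK]]; apply/barrierP.
    by split; [apply: subset_trans sBC | constructor 2].
  split; [exact: subset_trans sBC | constructor 3; exists y => //].
  exact: subset_trans sBK.
- move=> g A B /barrierP[sAB AB]; apply/barrierP; split; first by rewrite conjSg.
  case: AB => [-> | ltBH | [y -> sAK]]; first by constructor 1.
    by constructor 2; rewrite cardJg.
  constructor 3; exists (y * g); first by apply: val_inj; rewrite /= conjsgM.
  by rewrite conjsgM conjSg.
move=> A B L /barrierP[sAB AB] sLB; apply/barrierP; split; first exact: subsetIr.
case: AB => [-> | ltBH | [y defB sAK]].
- by constructor 1; apply/val_inj/setIidPr.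
- by constructor 2; apply: leq_ltn_trans ltBH; apply: subset_leq_card.
have [ltLH | leHL] := ltnP #|L| #|H|; first by constructor 2.
constructor 3; exists y; last exact: subset_trans (subsetIl _ _) sAK.
by rewrite -defB; apply/val_inj/eqP; rewrite eqEcard sLB defB cardJg.
Qed.

Lemma mem_barrier K H : K \subset H -> (K, H) \in barrier K H.
Proof.
move=> sKH; apply/barrierP; split=> //; constructor 3.
by exists 1; rewrite ?conjsg1 //; apply: val_inj; rewrite /= conjsg1.
Qed.

(** A proper transfer to [H] in the barrier has its source inside a conjugate of
[K] under the normaliser of [H], and a conjugate of [K] is too large to fit
there properly. *)
Lemma barrierJ K H g :
    K \subset H -> ((K :^ g)%G, H) \in barrier K H ->
  exists2 h, h \in 'N(H) & K :^ h = K :^ g.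
Proof.
move=> sKH /barrierP[_ [defH | | [y /(congr1 val)/= defH sKgy]]].
- have eKH: K :=: H by apply/eqP; rewrite eqEcard sKH -defH cardJg leqnn.
  by exists 1; rewrite ?group1 // conjsg1 {1}eKH -defH.
- by rewrite ltnn.
exists y; first exact/normP/esym.
by apply/esym/eqP; rewrite eqEcard sKgy !cardJg leqnn.
Qed.

Lemma bij_lossless : bijective (@pi_pull_liftable gT) -> lossless gT.
Proof.
case=> push _ pushK K H g sKH sKgH.
pose S : transfer_system gT :=
    exist _ (barrier K H) (barrier_is_transfer_system K H).
have /subsetP satS := surj_pull_saturated (pushK S).
have [|h Nh eK] := @barrierJ K H g^-1 sKH; last first.
  by exists h^-1; rewrite ?groupV ?invgK.
apply: satS; rewrite inE /= sKgH class_ofJ.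
exact/(@mem_pi_push S)/mem_barrier.
Qed.

End Corollary.

Theorem corollary2p14 (gT : finGroupType) :
  (lossless gT -> bijective (@pi_pull_liftable gT)) /\
  (bijective (@pi_pull_liftable gT) -> lossless gT).
Proof. by split; [apply: lossless_bij | apply: bij_lossless]. Qed.
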